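(* Let $n>1$, $N\ge1$, and let $p_1,\dots,p_n$ be nonnegative integers with $p_1+\cdots+p_n\le N$. Let $q_m=p_1+\cdots+p_m$ for $1\le m\le n$. Let $\mathcal{X}^{(N)}_{\mathbf q}$ be the set of $x=(x_m(i),\ i\in\mathbb{Z}_N,\ 1\le m\le n)\in\{1,\infty\}^{\mathbb{Z}_N\times\{1,\dots,n\}}$ such that $\#\{i\in\mathbb{Z}_N:x_m(i)=1\}=q_m$ for every $m=1,\dots,n$. Let $x$ be uniformly distributed on $\mathcal{X}^{(N)}_{\mathbf q}$. Define $v_1=x_1$ and, recursively, $v_{m+1}=F_m^{(N)}(v_m,x_{m+1})$ for $m=1,\dots,n-1$, where $F_m^{(N)}$ is the multiclass collapse operator (defined in the context). Then, for each $m\in\{1,\dots,n\}$, the distribution of $v_m$ is the stationary distribution of the $m$-type TASEP on $\mathbb{Z}_N$ with $p_r$ particles of class $r$, for $r=1,\dots,m$.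
   Context: $\mathbb{Z}_N$ is the cycle of integers mod $N$. For $n\ge 1$ let $\mathcal{U}_n^{(N)}=(\{1,2,\dots,n\}\cup\{\infty\})^{\mathbb{Z}_N}$, with the order $1<2<\cdots<n<\infty$. For $u\in\mathcal{U}_n^{(N)}$, $u(i)=r\le n$ means that there is a particle of class $r$ at site $i$, and $u(i)=\infty$ means that there is a hole at $i$. For $u\in\mathcal{U}_n^{(N)}$ and $i\in\mathbb{Z}_N$, let $u^{(i-1,i)}$ be the configuration which agrees with $u$ off $\{i-1,i\}$ and has $u^{(i-1,i)}(i-1)=\min\{u(i-1),u(i)\}$, $u^{(i-1,i)}(i)=\max\{u(i-1),u(i)\}$. The $n$-type TASEP on $\mathbb{Z}_N$ is the continuous-time Markov chain on $\mathcal{U}_n^{(N)}$ in which bells ring at each site as independent Poisson processes of rate 1, and when the bell at site $i$ rings the current configuration $u$ is replaced by $u^{(i-1,i)}$. The number of particles of each class is conserved; ''the stationary distribution with $p_r$ particles of class $r$'' is the unique stationary distribution concentrated on configurations having exactly $p_r$ particles of class $r$ for each $r$. Collapse operator $F_m^{(N)}$ ($m\ge1$). Let $a\in\mathcal{U}_m^{(N)}$ and $s\in\mathcal{U}_1^{(N)}=\{1,\infty\}^{\mathbb{Z}_N}$. Put $\mathcal{A}_r=\{i:a(i)=r\}$ for $r\le m$ and $\mathcal{S}=\{i:s(i)=1\}$, and assume $|\mathcal{A}_1\cup\cdots\cup\mathcal{A}_m|\le|\mathcal{S}|$. Construct disjoint sets $\mathcal{D}_1,\dots,\mathcal{D}_m\subseteq\mathcal{S}$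 successively for $r=1,\dots,m$: start with $\mathcal{D}_r=\emptyset$; take the sites $i\in\mathcal{A}_r$ one at a time in an arbitrary order, and for each add to $\mathcal{D}_r$ the first $j$ in the list $i,i+1,i+2,\dots$ (taken cyclically) such that $j\in\mathcal{S}\setminus(\mathcal{D}_1\cup\cdots\cup\mathcal{D}_{r-1})$ and $j$ has not yet been added to $\mathcal{D}_r$ (the resulting set $\mathcal{D}_r$ does not depend on the order). Let $\mathcal{D}_{m+1}=\mathcal{S}\setminus(\mathcal{D}_1\cup\cdots\cup\mathcal{D}_m)$. Then $F_m^{(N)}(a,s)=d\in\mathcal{U}_{m+1}^{(N)}$, where $d(i)=r$ if $i\in\mathcal{D}_r$ $(1\le r\le m+1)$ and $d(i)=\infty$ if $i\notin\mathcal{S}$. *)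

(* Defs.v *)
From HB Require Import structures.
From mathcomp Require Import all_boot all_order all_algebra.
From mathcomp Require Import reals topology normedtype sequences.

Set Implicit Arguments.
Unset Strict Implicit.
Unset Printing Implicit Defensive.

Import Order.TTheory GRing.Theory Num.Theory.
Import numFieldNormedType.Exports.

Local Open Scope ring_scope.

(* The cycle Z_N is 'I_N, with i + 1 = ordS i and i - 1 = ord_pred i taken
   modulo N (this is meaningful for every N >= 1, unlike 'Z_N).
   Classes are counted from 0: in a configuration with n classes the ordinal
   r < n stands for a particle of class r + 1 and ord_max (= n) stands for a
   hole, so the order of 'I_n.+1 is 1 < 2 < ... < n < oo.  Likewise
   line x k, output x k, p k and partial_sum p k below stand for x_(k+1),
   v_(k+1), p_(k+1) and q_(k+1), and class_departures r for D_(r+1). *)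
Definition config (N n : nat) : finType := {ffun 'I_N -> 'I_n.+1}.

Section Tasep.
Variables N n : nat.

Definition bell (i : 'I_N) (u : config N n) : config N n :=
  [ffun j => if j == ord_pred i then Order.min (u (ord_pred i)) (u i)
             else if j == i then Order.max (u (ord_pred i)) (u i)
             else u j].

Definition class_sites (u : config N n) (r : nat) : {set 'I_N} :=
  [set i | u i == r :> nat].

Definition has_content (p : nat -> nat) (u : config N n) : Prop :=
  forall r : nat, (r < n)%N -> #|class_sites u r| = p r.

Variable R : realType.

Definition tasep_generator (f : config N n -> R) : config N n -> R :=
  fun u => \sum_(i < N) (f (bell i u) - f u).

(* P_t(u, w) = (exp(t L) 1_w)(u), L being the generator: the probability that
   the chain started from u is at w at time t. *)
Definition tasep_transition (t : R) (u w : config N n) : R :=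
  limn (series (fun k : nat =>
    t ^+ k / k`!%:R * iter k tasep_generator (fun u' => (u' == w)%:R) u)).

Definition is_distribution (T : finType) (mu : {ffun T -> R}) : Prop :=
  (forall x, 0 <= mu x) /\ \sum_x mu x = 1.

Definition tasep_stationary (mu : {ffun config N n -> R}) : Prop :=
  forall (t : R) (w : config N n), 0 <= t ->
    \sum_u mu u * tasep_transition t u w = mu w.

Definition tasep_stationary_with (p : nat -> nat)
    (mu : {ffun config N n -> R}) : Prop :=
  [/\ is_distribution mu, tasep_stationary mu
    & forall u, mu u != 0 -> has_content p u].

End Tasep.

Section Collapse.
Variable N : nat.
Implicit Types (T D : {set 'I_N}) (i j : 'I_N).

(* traject (@ordS N) i N is the list i, i + 1, ..., i + N - 1. *)
Definition first_from T i : option 'I_N :=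
  ohead [seq j <- traject (@ordS N) i N | j \in T].

Definition add_first T D i : {set 'I_N} :=
  if first_from (T :\: D) i is Some j then j |: D else D.

Definition departures T (arrivals : seq 'I_N) : {set 'I_N} :=
  foldl (add_first T) set0 arrivals.

Lemma iter_ordS_id i : iter N (@ordS N) i = i.
Proof.
apply/val_inj => /=; suff E k : iter k (@ordS N) i = ((i + k) %% N)%N :> nat.
  by rewrite E modnDr modn_small.
elim: k => [|k IH]; first by rewrite addn0 modn_small.
by rewrite iterS /= IH -addn1 modnDml addn1 addnS.
Qed.

Lemma first_from_removed T i j : first_from T i = Some j ->
  first_from (T :\ j) i = first_from (T :\ j) j.
Proof.
rewrite /first_from => Tij.
have [k kN [jE noT]] : exists2 k, (k <= N)%N &
    j = iter k (@ordS N) i /\ [seq l <- traject (@ordS N) i k | l \in T] = [::].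
  have gen M : forall l,
    ohead [seq u <- traject (@ordS N) l M | u \in T] = Some j ->
    exists2 k, (k <= M)%N &
    j = iter k (@ordS N) l /\ [seq u <- traject (@ordS N) l k | u \in T] = [::].
    elim: M => //= M IH l; case: ifP => lT /=; first by move=> [<-]; exists 0%N.
    by move=> /IH[k kM [jE kT]]; exists k.+1; rewrite // iterSr /= lT.
  exact: gen.
have noTj : [seq l <- traject (@ordS N) i k | l \in T :\ j] = [::].
  apply/eqP; rewrite -[_ == _]negbK -has_filter; apply/negP => /hasP[l li].
  rewrite !inE => /andP[_ lT].
  by have := mem_filter (fun u => u \in T) l (traject (@ordS N) i k);
    rewrite noT li /= lT.
have iE : iter (N - k)%N (@ordS N) j = i.
  by rewrite jE -iterD subnK // iter_ordS_id.
have -> : traject (@ordS N) i N =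
    traject (@ordS N) i k ++ traject (@ordS N) j (N - k)%N.
  by rewrite jE -trajectD subnKC.
have -> : traject (@ordS N) j N =
    traject (@ordS N) j (N - k)%N ++ traject (@ordS N) i k.
  by rewrite -[in X in _ ++ X]iE -trajectD subnK.
by rewrite !filter_cat noTj cats0.
Qed.

Lemma first_from_other T i j k : first_from T i = Some j -> k != j ->
  first_from (T :\ k) i = Some j.
Proof.
rewrite /first_from => + kj; elim: (traject _ _ _) => //= x s IH.
rewrite !inE; case: (x \in T) => /=; last by rewrite andbF.
by move=> [->]; rewrite eq_sym kj.
Qed.

Lemma first_from_none T i k : first_from T i = None ->
  first_from (T :\ k) i = None.
Proof.
rewrite /first_from; elim: (traject _ _ _) => //= x s IH.
by rewrite !inE; case: (x \in T) => //=; rewrite andbF.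
Qed.

Lemma add_firstC T D i j :
  add_first T (add_first T D i) j = add_first T (add_first T D j) i.
Proof.
have DU k : T :\: (k |: D) = (T :\: D) :\ k by rewrite setDDl setUC.
rewrite /add_first.
case Ei: (first_from (T :\: D) i) => [k|];
  case Ej: (first_from (T :\: D) j) => [l|];
  rewrite ?Ei ?Ej ?DU //; last 2 first.
- by rewrite first_from_none.
- by rewrite first_from_none.
have [kl|kl] := eqVneq k l.
  subst l; rewrite (first_from_removed Ei) (first_from_removed Ej).
  by [].
rewrite (first_from_other Ej kl) (first_from_other Ei) 1?eq_sym //.
by rewrite setUCA.
Qed.

(* The departure sites do not depend on the order in which the arrivals are
   served. *)
Lemma departures_perm T s1 s2 :
  perm_eq s1 s2 -> departures T s1 = departures T s2.
Proof.
rewrite /departures; elim: s1 s2 (set0 : {set 'I_N}) => [|i s1 IH] s2 D.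
  by rewrite perm_sym => /perm_nilP ->.
move=> s12; have i2 : i \in s2 by rewrite -(perm_mem s12) mem_head.
case/splitPr: i2 s12 => u w s12.
have {}s12 : perm_eq s1 (u ++ w).
  by rewrite -(perm_cons i) (perm_trans s12) // -cat1s perm_catCA.
rewrite /= (IH _ _ s12) !foldl_cat /=; congr foldl.
by elim: u D {s12} => //= l u IHu D; rewrite add_firstC IHu.
Qed.

Variable m : nat.
Variables (a : config N m) (s : config N 1).

Definition services : {set 'I_N} := class_sites s 0.

(* The union of the first r departure sets. *)
Fixpoint used_services (r : nat) : {set 'I_N} :=
  if r is r'.+1
  then used_services r' :|:
       departures (services :\: used_services r') (enum (class_sites a r'))
  else set0.

Definition class_departures (r : nat) : {set 'I_N} :=
  departures (services :\: used_services r) (enum (class_sites a r)).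

(* The operator F_m; the two inords are the classes r + 1 and m + 1. *)
Definition collapse : config N m.+1 :=
  [ffun i => if i \notin services then ord_max
             else if [pick r : 'I_m | i \in class_departures r] is Some r
             then inord r else inord m].

End Collapse.

Section Multiline.
Variables N n : nat.

Definition partial_sum (p : nat -> nat) (k : nat) : nat :=
  (\sum_(r < k.+1) p r)%N.

Definition lines : finType := {ffun 'I_n -> config N 1}.

Definition multiline_set (q : nat -> nat) : {set lines} :=
  [set x : lines | [forall k : 'I_n, #|class_sites (x k) 0| == q k]].

(* Junk value (no particle) for k >= n. *)
Definition line (x : lines) (k : nat) : config N 1 :=
  if insub k is Some k' then x k' else [ffun=> ord_max].

Fixpoint output (x : lines) (k : nat) : config N k.+1 :=
  if k is k'.+1 then collapse (output x k') (line x k'.+1) else line x 0.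

End Multiline.

Definition uniform_on (R : realType) (T : finType) (A : {set T}) :
    {ffun T -> R} :=
  [ffun x => if x \in A then #|A|%:R^-1 else 0].

Definition law (R : realType) (T U : finType) (mu : {ffun T -> R})
    (f : T -> U) : {ffun U -> R} :=
  [ffun u => \sum_(x | f x == u) mu x].

(* Main.v *)
Require Import Defs.
From mathcomp Require Import boolp classical_sets.
From mathcomp Require Import all_boot all_order all_fingroup all_algebra.
From mathcomp Require Import reals topology normedtype sequences.
From mathcomp Require Import zify ring lra.

(* Each line of the multi-line configuration is one step of a tandem of queues:
   D_1, ..., D_r together are the departures of the queue on the cycle with
   arrivals A_1, ..., A_r and services S, and this departure set is determined
   by the queue-length recursion.  Applying the bell at i to the departures
   amounts to applying the bell at i to the services and the bell at i
   (if there is a service at i) or at i + 1 (otherwise) to the arrivals.  Hence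
   the bell of the TASEP on v_m lifts to a map on pairs (site, multi-line
   configuration) which is a bijection, so the uniform law is preserved and the
   law of v_m is invariant.  It charges every configuration with the right
   content, since the lines {v <= 1}, ..., {v <= m} have output v; uniqueness
   follows by the minimum principle because adjacent transpositions generate
   the symmetric group. *)

Set Implicit Arguments.
Unset Strict Implicit.
Unset Printing Implicit Defensive.

Import Order.TTheory GRing.Theory Num.Theory.
Import numFieldNormedType.Exports.

(** * The queue on the cycle *)

Section Queue.
Variable N : nat.
Implicit Types (a Q : 'I_N -> nat) (S D A : {set 'I_N}) (i j k : 'I_N).

(* Arrivals come at the sites k with multiplicity a k, D is the set of
   departure sites, and Q k customers are left just after the service at k. *)
Definition queue_departures a S Q D : Prop :=
  [/\ D \subset S,
      forall k, (Q k + (k \in D) = Q (ord_pred k) + a k)%N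
    & forall k, k \in S -> k \notin D -> Q k = 0%N].

Lemma iter_ordS_surj i j : exists t, j = iter t (@ordS N) i.
Proof.
exists (j + N - i)%N; apply/val_inj => /=.
have E t : iter t (@ordS N) i = ((i + t) %% N)%N :> nat.
  elim: t => [|t IH]; first by rewrite addn0 modn_small.
  by rewrite iterS /= IH -addn1 modnDml addn1 addnS.
have iN := ltn_ord i; rewrite E (_ : i + (j + N - i) = j + N)%N; last by lia.
by rewrite modnDr modn_small.
Qed.

(** Summing the balance equation around the cycle cancels the queue lengths, because [ord_pred]
    permutes the sites. *)
Lemma sum_queue_departures a S Q D :
  queue_departures a S Q D -> #|D| = (\sum_k a k)%N.
Proof.
case=> _ qD _; apply/eqP; rewrite -(eqn_add2l (\sum_k Q k)); apply/eqP.
rewrite -sum1_card [X in (_ + X)%N]big_mkcond /= -big_split /=.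
transitivity (\sum_k (Q (ord_pred k) + a k))%N.
  by apply: eq_bigr => k _; rewrite -(qD k); case: (k \in D).
by rewrite big_split /= [in RHS](reindex_inj (@ord_pred_inj N)).
Qed.

Lemma queue_le a S Q D Q' D' j :
  queue_departures a S Q D -> queue_departures a S Q' D' -> Q j = 0%N ->
  forall k, (Q k <= Q' k)%N.
Proof.
move=> [DS qD eD] [DS' qD' eD'] Qj k.
have [t ->] := iter_ordS_surj j k; elim: t => [|t IH] /=; first by rewrite Qj.
set l := ordS _; have := qD l; have := qD' l; rewrite !ordSK.
have [/(subsetP DS)|lS] := boolP (l \in D); first by lia.
case: (boolP (l \in D')) => [/(subsetP DS') lS'|]; last by lia.
by rewrite (eD _ lS').
Qed.

Lemma queue_departures_unique a S Q D Q' D' :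
  queue_departures a S Q D -> queue_departures a S Q' D' -> D = D'.
Proof.
move=> q q'; have cDD' : #|D| = #|D'|.
  by rewrite (sum_queue_departures q) (sum_queue_departures q').
have [[DS qD eD] [DS' qD' eD']] := (q, q').
have [SD|] := boolP (S \subset D).
  have E : D = S by apply/eqP; rewrite eqEsubset DS.
  by apply/esym/eqP; rewrite eqEcard cDD' leqnn andbT E.
case/subsetPn=> j jS jD.
have [SD|] := boolP (S \subset D').
  have E : D' = S by apply/eqP; rewrite eqEsubset DS'.
  by apply/eqP; rewrite eqEcard -cDD' leqnn andbT E.
case/subsetPn=> j' jS' jD'; apply/setP => k.
have Qle := queue_le q q' (eD _ jS jD); have Qge := queue_le q' q (eD' _ jS' jD').
have QQ l : Q l = Q' l by apply/eqP; rewrite eqn_leq Qle Qge.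
by have := qD k; have := qD' k; rewrite !QQ; do 2!case: (_ \in _) => //=; lia.
Qed.
Lemma first_fromP S i j : first_from S i = Some j ->
  exists t, [/\ j = iter t (@ordS N) i, j \in S
    & {in traject (@ordS N) i t, forall k, k \notin S}].
Proof.
suff gen M : ohead [seq k <- traject (@ordS N) i M | k \in S] = Some j ->
    exists t, [/\ j = iter t (@ordS N) i, j \in S
      & {in traject (@ordS N) i t, forall k, k \notin S}] by exact: gen.
elim: M i => //= M IH i.
have [iS [<-]|iS /IH[t [jt jS tS]]] := boolP (i \in S); first by exists 0%N.
exists t.+1; split; rewrite // ?iterSr //= => k; rewrite inE.
by case/predU1P => [->|/tS].
Qed.

Lemma first_from_exists S i : S != set0 -> first_from S i.
Proof.
case/set0Pn=> j jS; rewrite /first_from.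
suff : has (mem S) (traject (@ordS N) i N).
  by rewrite has_filter; case: [seq _ <- _ | _].
have [t jt] := iter_ordS_surj i j; apply/hasP; exists j => //.
(* Only the first [N] sites are searched; since [N] steps make a full turn, [t] may be reduced
   modulo [N]. *)
rewrite jt (divn_eq t N) iterD; apply/trajectP; exists (t %% N)%N.
  by rewrite ltn_mod (leq_ltn_trans _ (ltn_ord i)).
rewrite -iterD addnC iterD; congr iter; elim: (t %/ N)%N => // q IH.
by rewrite mulSn iterD IH iter_ordS_id.
Qed.

Lemma card_departures S (s : seq 'I_N) : (#|departures S s| <= size s)%N.
Proof.
elim/last_ind: s => [|s i IH]; first by rewrite cards0.
rewrite /departures foldl_rcons -/(departures S s) size_rcons /add_first.
case: first_from => [j|]; last exact: leqW.
by rewrite cardsU1; case: (_ \notin _) => //=; exact: leqW.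
Qed.

(* A new arrival at i waits at every site before its departure site. *)
Lemma departures_queue S (s : seq 'I_N) : (size s <= #|S|)%N ->
  exists Q, queue_departures (fun k => count_mem k s) S Q (departures S s).
Proof.
elim/last_ind: s => [_|s i IH].
  exists (fun=> 0%N); split=> // [|k]; first exact: sub0set.
  by rewrite inE.
rewrite size_rcons => sS; have [Q [DS qD eD]] := IH (ltnW sS).
have cD := leq_ltn_trans (card_departures S s) sS.
rewrite /departures foldl_rcons -/(departures S s) /add_first.
move: (departures S s) => D in DS qD eD cD *.
(* There are fewer departures so far than services, so the new customer does find a free service. *)
have : S :\: D != set0.
  rewrite setD_eq0; apply/negP => SD; move: cD.
  by rewrite ltnNge (subset_leq_card SD).
move/(@first_from_exists _ i); case E: first_from => [j|] // _.
have [t [jt]] := first_fromP E; rewrite inE => /andP[jD jS] tS.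
exists (fun k => Q k + count_mem k (traject (@ordS N) i t))%N; split.
- by rewrite subUset sub1set jS.
- move=> k; have := qD k; rewrite -cats1 count_cat /= addn0 !inE.
  (* Flow conservation along the walk of the new customer, which enters at [i] and leaves at [j]. *)
  have : (count_mem k (traject (@ordS N) i t) + (j == k) =
          count_mem (ord_pred k) (traject (@ordS N) i t) + (i == k))%N.
    have -> : count_mem (ord_pred k) (traject (@ordS N) i t) =
              count_mem k (traject (@ordS N) (ordS i) t).
      elim: (t) (i) => //= M IHM l.
      rewrite IHM; congr (nat_of_bool _ + _)%N.
      by rewrite -(inj_eq (@ordS_inj N)) ord_predK.
    rewrite addnC [RHS]addnC -[RHS]/(count_mem k (traject (@ordS N) i t.+1)).
    by rewrite trajectSr -cats1 count_cat /= addn0 jt addnC.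
  move: (count_mem k (traject _ _ _)) (count_mem (ord_pred k) _) => c c'.
  rewrite [k == j]eq_sym; move: (count_mem k s) => c''.
  case: (eqVneq j k) => [<-|_]; rewrite ?(negPf jD) /=.
    by move: (i == j) (Q j) (Q (ord_pred j)) => b x y; lia.
  by move: (k \in D) (i == k) (Q k) (Q (ord_pred k)) => b x y z; lia.
- move=> k kS; rewrite !inE negb_or => /andP[kj kD].
  rewrite (eD _ kS kD) add0n; apply/count_memPn/negP => /tS.
  by rewrite inE kD kS.
Qed.

(** The effect of a bell on the sets [{u < r}]: the minimum becomes a union and the maximum an
    intersection. *)
Definition bell_set i A : {set 'I_N} :=
  [set j | if j == ord_pred i then (ord_pred i \in A) || (i \in A)
           else if j == i then (ord_pred i \in A) && (i \in A)
           else j \in A].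

Lemma bell_setS i A D : A \subset D -> bell_set i A \subset bell_set i D.
Proof.
move/subsetP=> AD; apply/subsetP => j; rewrite !inE.
case: ifP => _; first by case/orP=> /AD ->; rewrite ?orbT.
by case: ifP => _; [case/andP=> /AD -> /AD -> | move/AD].
Qed.

Definition next_bell S i := if i \in S then i else ordS i.

Lemma bell_set_id i A : (i \in A) ==> (ord_pred i \in A) -> bell_set i A = A.
Proof.
move=> iA; apply/setP => j; rewrite inE; case: eqVneq => [->|_].
  by move: iA; case: (i \in A); case: (_ \in A).
by case: eqVneq => [->|] //; move: iA; case: (i \in A); case: (_ \in A).
Qed.

(** The new queue lengths differ from [Q] at one site only: at [i - 1] if there is a service at [i],
    and at [i] otherwise. All conditions are then local and reduce to finitely many cases. *)
Lemma queue_bell A S Q D i :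
  queue_departures (fun k => (k \in A) : nat) S Q D ->
  exists Q', queue_departures
    (fun k => (k \in bell_set (next_bell S i) A) : nat) (bell_set i S) Q' (bell_set i D).
Proof.
case=> DS qD eD; rewrite /next_bell.
(* On the cycle with one site every bell is the identity. *)
have [Ei|ni] := eqVneq (ord_pred i) i.
  have idA A' : bell_set i A' = A' by apply: bell_set_id; rewrite Ei implybb.
  have Si : ordS i = i by rewrite -{1}Ei ord_predK.
  by exists Q; rewrite Si if_same !idA; split.
have npi : ord_pred (ord_pred i) != ord_pred i by rewrite (inj_eq (@ord_pred_inj N)).
pose p := ord_pred i; have nip : (i == p) = false by rewrite eq_sym (negPf ni).
have qi := qD i; rewrite -/p in qi.
have [iS|iS] := boolP (i \in S).
  (* After the bell there is a service at [p], so one customer leaves there if any is present; the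
     truncated subtraction gives 0 when there is none. *)
  pose Q' k := if k == p then (Q (ord_pred p) + (k \in bell_set i A) - 1)%N else Q k.
  exists Q'; rewrite /Q'; have eDi := eD i iS.
  have [qpE qiE eDpE eDiE] :
    [/\ (Q (ord_pred p) + ((p \in A) || (i \in A)) - 1 + ((p \in D) || (i \in D)) =
          Q (ord_pred p) + ((p \in A) || (i \in A)))%N,
        (Q i + ((p \in D) && (i \in D)) =
          Q (ord_pred p) + ((p \in A) || (i \in A)) - 1 + ((p \in A) && (i \in A)))%N,
        ~~ ((p \in D) || (i \in D)) ->
          (Q (ord_pred p) + ((p \in A) || (i \in A)) - 1 = 0)%N
      & p \in S -> ~~ ((p \in D) && (i \in D)) -> Q i = 0%N].
    move: (qD p) (eD p) (subsetP DS p) qi eDi.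
    move: (p \in S) (p \in A) (p \in D) (i \in A) (i \in D).
    move: (Q p) (Q i) (Q (ord_pred p)) => x y z.
    by do 5!case=> //=; split; lia.
  split.
  - exact: bell_setS.
  - move=> k; have := qD k; rewrite (inj_eq (@ord_pred_inj N)) !inE -/p.
    have [->|kp] := eqVneq k p; first by rewrite [p == i]eq_sym nip.
    by have [->|//] := eqVneq k i; rewrite -/p eqxx.
  - move=> k; have := eD k; rewrite !inE -/p.
    have [->|kp] := eqVneq k p; first by move=> _ _; exact: eDpE.
    by have [->|//] := eqVneq k i; rewrite iS andbT => _; exact: eDiE.
have iD : (i \in D) = false by apply: contraNF iS => /(subsetP DS).
rewrite (@bell_set_id i S) ?(@bell_set_id i D) ?(negPf iS) ?iD //.
have qj := qD (ordS i); rewrite ordSK in qj.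
have nji : (ordS i == i) = false by rewrite -(inj_eq (@ord_pred_inj N)) ordSK nip.
(* Services and departures are unchanged, while an arrival at [i + 1] may move back to [i]. With no
   service at [i], it just waits there. *)
exists (fun k => if k == i then Q p + (k \in bell_set (ordS i) A) else Q k)%N.
split=> // k; last first.
  by have [->|_] := eqVneq k i; [rewrite (negPf iS) | exact: eD].
have := qD k; rewrite !inE ordSK -[ord_pred k == i](inj_eq (@ordS_inj N)) ord_predK.
have [->|ki] := eqVneq k i.
  by rewrite [i == ordS i]eq_sym nji -/p iD !addn0.
have [->|//] := eqVneq k (ordS i); move: qj qi; rewrite iD.
move: (ordS i \in D) (ordS i \in A) (i \in A) => [] [] [] /=;
  move: (Q p) (Q i) (Q _) => *; lia.
Qed.

Lemma departures_sub S (s : seq 'I_N) : departures S s \subset S.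
Proof.
elim/last_ind: s => [|s i IH]; first exact: sub0set.
rewrite /departures foldl_rcons -/(departures S s) /add_first.
case E: first_from => [j|] //; rewrite subUset IH sub1set andbT.
by have [t [_]] := first_fromP E; rewrite inE => /andP[].
Qed.

Lemma departures_set_queue S A : (#|A| <= #|S|)%N ->
  exists Q, queue_departures (fun k => (k \in A) : nat) S Q (departures S (enum A)).
Proof.
rewrite [#|A|]cardE => /departures_queue[Q [DS qD eD]]; exists Q; split=> // k.
by rewrite qD count_uniq_mem ?enum_uniq // mem_enum.
Qed.

(** Both sides are departure sets of the same queue, so uniqueness identifies them. *)
Lemma departures_bell S A i : (#|A| <= #|S|)%N ->
  #|bell_set (next_bell S i) A| = #|A| -> #|bell_set i S| = #|S| ->
  departures (bell_set i S) (enum (bell_set (next_bell S i) A)) =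
  bell_set i (departures S (enum A)).
Proof.
move=> AS cA cS; have [Q /(@queue_bell _ _ _ _ i)[Q' qQ']] := departures_set_queue AS.
have [|Q'' qQ''] := @departures_set_queue (bell_set i S) (bell_set (next_bell S i) A).
  by rewrite cA cS.
exact: queue_departures_unique qQ'' qQ'.
Qed.

Lemma card_departures_set S A : (#|A| <= #|S|)%N -> #|departures S (enum A)| = #|A|.
Proof.
case/departures_set_queue=> Q /sum_queue_departures ->.
by rewrite -sum1_card [RHS]big_mkcond.
Qed.

(** Every customer is served on arrival: the queue that is empty everywhere is a solution. *)
Lemma departures_id S A : A \subset S -> departures S (enum A) = A.
Proof.
move=> AS; have [Q qQ] := departures_set_queue (subset_leq_card AS).
by apply: (queue_departures_unique qQ (_ : queue_departures _ _ (fun=> 0%N) _)); split.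
Qed.

(** Removing [U] from the services amounts to starting with [U] already occupied, so the successive
    rounds for the classes merge into a single one. *)
Lemma foldl_add_first S D U (s : seq 'I_N) :
  foldl (add_first S) (U :|: D) s = U :|: foldl (add_first (S :\: U)) D s.
Proof.
elim: s D => //= i s IH D; rewrite -IH; congr foldl; rewrite /add_first setDDl.
by case: first_from => // j; rewrite setUCA.
Qed.

End Queue.

(** * Level sets of configurations and the collapse operator *)

Definition below N n (r : nat) (u : config N n) : {set 'I_N} := [set i | (u i < r)%N].

Lemma below_bell N n r i (u : config N n) :
  below r (bell i u) = bell_set i (below r u).
Proof.
apply/setP => j; rewrite !inE !ffunE.
have minE (x y : 'I_n.+1) : (Order.min x y < r)%N = (x < r)%N || (y < r)%N.
  by rewrite /Order.min ltEord; case: ifP; lia.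
have maxE (x y : 'I_n.+1) : (Order.max x y < r)%N = (x < r)%N && (y < r)%N.
  by rewrite /Order.max ltEord; case: ifP; lia.
by case: ifP => _; [rewrite minE | case: ifP => _; rewrite ?maxE].
Qed.

Lemma bell_tperm N n i (u : config N n) :
  bell i u = if (u (ord_pred i) <= u i)%N then u
             else [ffun j => u (tperm (ord_pred i) i j)].
Proof.
apply/ffunP => j; rewrite ffunE /Order.min /Order.max ltEord.
have [ltu|ltu|/val_inj equ] := ltngtP (u (ord_pred i)) (u i).
- by do 2!case: eqP => [->|_] //.
- by rewrite ffunE; case: tpermP => [->|->|/eqP/negPf-> /eqP/negPf->] //;
    rewrite eqxx //; case: eqVneq => [<-|].
- by case: eqVneq => [->|_] //; case: eqVneq => [->|_].
Qed.

Lemma card_below_tperm N n r i (u : config N n) :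
  #|below r [ffun j => u (tperm (ord_pred i) i j)]| = #|below r u|.
Proof.
rewrite -[RHS](card_preimset _ (@perm_inj _ (tperm (ord_pred i) i))).
by apply: eq_card => j; rewrite !inE ffunE.
Qed.

Lemma card_below_bell N n r i (u : config N n) : #|below r (bell i u)| = #|below r u|.
Proof. by rewrite bell_tperm; case: ifP => // _; rewrite card_below_tperm. Qed.

Lemma below_inj N n (u v : config N n) :
  (forall r, (r <= n)%N -> below r u = below r v) -> u = v.
Proof.
move=> uv; apply/ffunP => i; apply/val_inj => /=.
wlog : u v uv / (u i < v i)%N.
  move=> W; case: (ltngtP (u i) (v i)) => // [lt_uv|lt_vu]; first exact: W.
  by apply/esym/W => // r /uv.
move=> ltuv; have /setP/(_ i) := uv (v i) (leq_ord _).
by rewrite !inE ltuv ltnn.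
Qed.

Lemma servicesE N (s : config N 1) : services s = below 1 s.
Proof. by apply/setP => i; rewrite !inE ltnS leqn0. Qed.

(** Serving the classes one after the other is one particular order of serving all arrivals of the
    first [r] classes, and the order does not matter. *)
Lemma used_servicesE N m (a : config N m) (s : config N 1) r :
  used_services a s r = departures (services s) (enum (below r a)).
Proof.
elim: r => [|r IH] /=.
  by rewrite /below (_ : [set _ | _] = set0) ?enum_set0 //; apply/setP=> i; rewrite !inE.
rewrite -foldl_add_first setU0 [X in foldl _ X _]IH -foldl_cat.
apply: departures_perm; apply: uniq_perm => [||i]; last 1 first.
- by rewrite mem_cat !mem_enum !inE [in RHS]ltnS; case: ltngtP.
- rewrite cat_uniq !enum_uniq andbT /=; apply/hasPn => i.
  by rewrite /= !mem_enum !inE => /eqP ->; rewrite ltnn.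
- exact: enum_uniq.
Qed.

Section Below_collapse.
Variables (N m : nat) (a : config N m) (s : config N 1).

Lemma used_servicesS r :
  used_services a s r.+1 = used_services a s r :|: class_departures a s r.
Proof. by []. Qed.

Lemma used_services_le r1 r2 : (r1 <= r2)%N ->
  used_services a s r1 \subset used_services a s r2.
Proof.
move/subnKC <-; elim: (r2 - r1)%N => [|r IH]; first by rewrite addn0.
by rewrite addnS used_servicesS (subset_trans IH) ?subsetUl.
Qed.

Lemma class_departuresP r i : i \in class_departures a s r ->
  i \in services s /\ i \notin used_services a s r.
Proof.
by move/(subsetP (departures_sub _ _)); rewrite inE => /andP[].
Qed.

Lemma used_services_class r i : i \in used_services a s r ->
  exists2 r', (r' < r)%N & i \in class_departures a s r'.
Proof.
elim: r => [|r IH]; first by rewrite inE.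
rewrite used_servicesS inE => /orP[/IH[r' lt_r' ir']|ir]; last by exists r.
by exists r' => //; exact: leqW.
Qed.

(** This reduces the multiclass operator to one single-class queue for each level [r]. *)
Lemma below_collapse r : (r <= m)%N ->
  below r (collapse a s) = departures (services s) (enum (below r a)).
Proof.
move=> le_rm; rewrite -used_servicesE; apply/setP => i; rewrite inE ffunE.
case: ifP => [iS|/negbFE iS].
  rewrite /= ltnNge (leqW le_rm); apply/esym/negP.
  by case/used_services_class=> r' _ /class_departuresP[]; rewrite (negPf iS).
case: pickP => [r' ir'|no_r].
  have lt_r'm := ltn_ord r'.
  rewrite inordK; last by lia.
  case: ltnP => [lt_r'|le_r].
    by rewrite (subsetP (used_services_le lt_r')) // used_servicesS inE ir' orbT.
  apply/esym/negP => ir; have [_ /negP[]] := class_departuresP ir'.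
  exact: (subsetP (used_services_le le_r)).
rewrite inordK; last by lia.
rewrite ltnNge le_rm; apply/esym/negP => /used_services_class[r' lt_r' ir'].
by have := no_r (Ordinal (leq_trans lt_r' le_rm)); rewrite /= ir'.
Qed.

Lemma below_collapse_max : below m.+1 (collapse a s) = services s.
Proof.
apply/setP => i; rewrite inE ffunE; case: ifP => [/negPf->|/negbFE->] /=.
  by rewrite ltnn.
case: pickP => [r _|_]; rewrite inordK ?ltnSn //.
  by rewrite leqW.
by rewrite !leqW.
Qed.

End Below_collapse.

Definition next_site N (s : config N 1) i := if s i == 0%N :> nat then i else ordS i.

(** Compare level sets: level [m.+1] is the service set, and each lower level is a departure set, to
    which [departures_bell] applies. *)
Lemma collapse_bell N m (a : config N m) (s : config N 1) i :
  (#|below m a| <= #|services s|)%N ->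
  collapse (bell (next_site s i) a) (bell i s) = bell i (collapse a s).
Proof.
move=> le_as.
have nextE : next_site s i = next_bell (services s) i by rewrite /next_bell inE.
have servE : services (bell i s) = bell_set i (services s).
  by rewrite !servicesE below_bell.
apply: below_inj => r; rewrite leq_eqVlt below_bell => /predU1P[->|lt_rm].
  by rewrite !below_collapse_max.
rewrite !below_collapse // servE !below_bell nextE departures_bell //.
- apply: leq_trans le_as; apply/subset_leq_card/subsetP => j.
  by rewrite !inE => /leq_trans; apply.
- by rewrite -below_bell card_below_bell.
- by rewrite servicesE -below_bell card_below_bell.
Qed.

(** * The multi-line process *)

Lemma card_belowS N n r (u : config N n) :
  #|below r.+1 u| = (#|below r u| + #|class_sites u r|)%N.
Proof.
rewrite -cardUI [X in (_ + X)%N](_ : _ = 0%N) ?addn0.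
  by apply: eq_card => i; rewrite !inE ltnS; case: ltngtP.
by apply: eq_card0 => i; rewrite !inE; case: ltngtP.
Qed.

Lemma has_contentP N n (p : nat -> nat) (u : config N n) :
  has_content p u <->
  (forall r, (r <= n)%N -> #|below r u| = (\sum_(s < r) p s)%N).
Proof.
split=> [up r|up r lt_rn].
  elim: r => [_|r IH lt_rn].
    by rewrite big_ord0; apply: eq_card0 => i; rewrite inE.
  by rewrite card_belowS up // IH 1?ltnW // big_ord_recr.
apply/eqP; rewrite -(eqn_add2l #|below r u|) -card_belowS !up //; last exact: ltnW.
by rewrite big_ord_recr.
Qed.

(** The site before the outgoing one tells the two cases apart: after the bell it holds a particle
    exactly when the bell met a particle at [i]. Then [back] undoes the possible swap, or just moves
    the site back. *)
Lemma flow_inj N : injective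
  (fun ix : 'I_N * config N 1 => (next_site ix.2 ix.1, bell ix.1 ix.2)).
Proof.
pose swap i (s : config N 1) : config N 1 := [ffun j => s (tperm (ord_pred i) i j)].
have swapK i : involutive (swap i) by move=> s; apply/ffunP => j; rewrite !ffunE tpermK.
pose back (ix : 'I_N * config N 1) :=
  if ix.2 (ord_pred ix.1) == 0%N :> nat then (ix.1, swap ix.1 ix.2)
  else (ord_pred ix.1, ix.2).
apply: (can_inj (g := back)) => -[i s] /=; rewrite bell_tperm /back /next_site /=.
case: (posnP (s i)) => [si|si].
  rewrite si; case: (leqP (s (ord_pred i)) 0) => [|_]; last first.
    by rewrite ffunE tpermL si swapK.
  rewrite leqn0 => sp; rewrite sp; congr pair; apply/ffunP => j; rewrite ffunE.
  by case: tpermP => [->|->|//]; apply/val_inj; rewrite /= si (eqP sp).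
have s1 j : (s j <= s i)%N by have := ltn_ord (s j); lia.
by rewrite s1 ordSK gtn_eqF.
Qed.

Section Multiline.
Variables N n : nat.
Implicit Types (ix : 'I_N * lines N n) (x y : lines N n) (i j : 'I_N).

Definition step (k : nat) ix : 'I_N * lines N n :=
  (next_site (line ix.2 k) ix.1,
   [ffun l : 'I_n => if l == k :> nat then bell ix.1 (ix.2 l) else ix.2 l]).

(* The reversible multi-line dynamics: a bell on the last line is passed on to
   the same site of the preceding line when it meets a service, and to the next
   site otherwise. *)
Fixpoint multi_bell (k : nat) ix : 'I_N * lines N n :=
  if k is k'.+1 then multi_bell k' (step k ix) else step 0 ix.

Lemma line_ord x (k : 'I_n) : line x k = x k.
Proof. by rewrite /line valK. Qed.

Lemma line_step k ix l : (k < n)%N ->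
  line (step k ix).2 l = if l == k then bell ix.1 (line ix.2 l) else line ix.2 l.
Proof.
move=> lt_kn; rewrite /line; case: insubP => [l' _ <-|]; first by rewrite ffunE.
by case: eqP => // ->; rewrite lt_kn.
Qed.

Lemma step_inj k : (k < n)%N -> injective (step k).
Proof.
move=> lt_kn [i x] [j y] E.
have E2 l := congr1 (fun z => line z.2 l) E.
have E1 : (next_site (line x k) i, bell i (line x k)) =
          (next_site (line y k) j, bell j (line y k)).
  congr pair; first by case: E.
  by have := E2 k; rewrite !line_step // eqxx.
have [-> xyk] := @flow_inj _ (i, line x k) (j, line y k) E1.
 congr pair; apply/ffunP => l; have := E2 l.
by rewrite !line_step // !line_ord; case: eqP => // lk; move: xyk; rewrite -lk !line_ord.
Qed.

Lemma multi_bell_inj k : (k < n)%N -> injective (multi_bell k).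
Proof.
elim: k => [|k IH] lt_kn ix iy; first exact: step_inj.
by move/(IH (ltnW lt_kn))/(step_inj lt_kn).
Qed.

Lemma multi_bell_line k ix l : (k < l)%N -> (k < n)%N ->
  line (multi_bell k ix).2 l = line ix.2 l.
Proof.
elim: k ix => [|k IH] ix lt_kl lt_kn; rewrite /multi_bell -/multi_bell.
  by rewrite line_step // gtn_eqF.
by rewrite IH 1?ltnW // line_step // gtn_eqF.
Qed.

Lemma output_line x y k : (forall l, (l <= k)%N -> line x l = line y l) ->
  output x k = output y k.
Proof.
elim: k => [|k IH] xy /=; first exact: xy.
by rewrite xy // IH // => l lk; exact/xy/leqW.
Qed.

Variable q : nat -> nat.

Lemma multiline_setP x :
  reflect (forall k, (k < n)%N -> #|services (line x k)| = q k)
          (x \in multiline_set N n q).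
Proof.
rewrite inE; apply: (iffP forallP) => [xq k lt_kn|xq k].
  by have := xq (Ordinal lt_kn); rewrite -line_ord => /eqP.
by rewrite -line_ord; apply/eqP/xq.
Qed.

Lemma step_multiline k ix : (k < n)%N ->
  ((step k ix).2 \in multiline_set N n q) = (ix.2 \in multiline_set N n q).
Proof.
move=> lt_kn; have cE l : #|services (line (step k ix).2 l)| = #|services (line ix.2 l)|.
  by rewrite line_step //; case: eqP => // _; rewrite !servicesE card_below_bell.
by apply/multiline_setP/multiline_setP => xq l lt_ln; rewrite -xq ?cE.
Qed.

Lemma multi_bell_multiline k ix : (k < n)%N ->
  ((multi_bell k ix).2 \in multiline_set N n q) = (ix.2 \in multiline_set N n q).
Proof.
elim: k ix => [|k IH] ix lt_kn; first exact: step_multiline.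
by rewrite -[RHS](step_multiline _ lt_kn); exact/IH/ltnW.
Qed.

End Multiline.

(** * Outputs of multi-line configurations *)

Section Output.
Variables (N n : nat) (p : nat -> nat).
Let q := partial_sum p.

Lemma partial_sum_le r k : (r <= k.+1)%N -> (\sum_(s < r) p s <= q k)%N.
Proof.
by rewrite /q /partial_sum => /subnKC <-; rewrite big_split_ord leq_addr.
Qed.

(** Each queue has as many departures as arrivals, so the counts pass from line to line; the top
    level is given by the number of services. *)
Lemma card_below_output (x : lines N n) k r :
  x \in multiline_set N n q -> (k < n)%N -> (r <= k.+1)%N ->
  #|below r (output x k)| = (\sum_(s < r) p s)%N.
Proof.
move=> /multiline_setP xq; elim: k r => [|k IH] r lt_kn.
  rewrite leq_eqVlt => /predU1P[->|]; first by rewrite /= -servicesE xq.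
  by rewrite ltnS leqn0 => /eqP ->; rewrite big_ord0; apply: eq_card0 => i; rewrite inE.
rewrite leq_eqVlt => /predU1P[->|lt_r] /=.
  by rewrite below_collapse_max xq.
have IHr := IH r (ltnW lt_kn) lt_r.
by rewrite below_collapse // card_departures_set ?IHr // xq // partial_sum_le // leqW.
Qed.

Lemma output_content (x : lines N n) k :
  x \in multiline_set N n q -> (k < n)%N -> has_content p (output x k).
Proof. by move=> xq lt_kn; apply/has_contentP => r; exact: card_below_output. Qed.

(** By induction, the bell passed on by the last line acts on the previous output as a bell at the
    next site; [collapse_bell] then turns the two bells into one bell at [i] on the new output. *)
Lemma output_multi_bell k i (x : lines N n) :
  x \in multiline_set N n q -> (k < n)%N ->
  output (multi_bell k (i, x)).2 k = bell i (output x k).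
Proof.
elim: k i x => [|k IH] i x xq lt_kn.
  exact: (@line_step _ _ 0 (i, x) 0 lt_kn).
have xq1 : (step k.+1 (i, x)).2 \in multiline_set N n q by rewrite step_multiline.
have line1 : line (step k.+1 (i, x)).2 k.+1 = bell i (line x k.+1).
  by rewrite line_step // eqxx.
have output1 : output (step k.+1 (i, x)).2 k = output x k.
  by apply: output_line => l lk; rewrite line_step // ltn_eqF.
have site1 : (step k.+1 (i, x)).1 = next_site (line x k.+1) i by [].
have lt_k := ltnW lt_kn.
rewrite -[LHS]/(collapse (output (multi_bell k (step k.+1 (i, x))).2 k)
                         (line (multi_bell k (step k.+1 (i, x))).2 k.+1)).
rewrite multi_bell_line // line1.
case: (step _ _) xq1 output1 site1 => [j y] xq1 output1 site1.
rewrite IH // output1 [j]site1.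
apply: collapse_bell; rewrite card_below_output //.
by move/multiline_setP: xq => -> //; rewrite partial_sum_le // leqW.
Qed.

Definition indicator (A : {set 'I_N}) : config N 1 :=
  [ffun i => if i \in A then ord0 else ord_max].

Lemma services_indicator A : services (indicator A) = A.
Proof. by apply/setP => i; rewrite !inE ffunE; case: ifP. Qed.

(** The lines from [m] on only need the right number of particles; they are filled with an initial
    segment of sites. *)
Definition lines_of m (w : config N m) : lines N n :=
  [ffun k : 'I_n => indicator
    (if (k < m)%N then below k.+1 w else [set i : 'I_N | (i < q k)%N])].

Lemma card_ord_lt k : (k <= N)%N -> #|[set i : 'I_N | (i < k)%N]| = k.
Proof.
move=> le_kN; have inj : injective (widen_ord le_kN).
  by move=> a b /(congr1 val) /= ab; apply/val_inj.
rewrite -[RHS](card_ord k) -(card_imset _ inj).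
apply: eq_card => i; rewrite inE; apply/idP/imsetP => [lt_ik|[j _ ->] //=].
by exists (Ordinal lt_ik) => //; exact/val_inj.
Qed.

Lemma lines_of_multiline m (w : config N m) : (q n.-1 <= N)%N ->
  has_content p w -> lines_of w \in multiline_set N n q.
Proof.
move=> qN /has_contentP wp; apply/multiline_setP => k lt_kn.
rewrite -[k]/(nat_of_ord (Ordinal lt_kn)) line_ord ffunE services_indicator /=.
case: ifP => [lt_km|_]; first by rewrite wp.
have le_qk : (q k <= N)%N.
  by apply: leq_trans qN; apply: partial_sum_le; lia.
exact: card_ord_lt.
Qed.

(** The level sets increase with the line, so every customer finds a service on arrival and nothing
    moves. *)
Lemma output_lines_of m (w : config N m.+1) : (m < n)%N ->
  output (lines_of w) m = w.
Proof.
move=> lt_mn; apply: below_inj.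
suff gen k : (k <= m)%N -> forall r, (r <= k.+1)%N ->
    below r (output (lines_of w) k) = below r w by exact: gen.
have lineE l : (l <= m)%N -> services (line (lines_of w) l) = below l.+1 w.
  move=> le_lm; have lt_ln := leq_ltn_trans le_lm lt_mn.
  rewrite -[l in line _ l]/(nat_of_ord (Ordinal lt_ln)) line_ord ffunE.
  by rewrite services_indicator /= ltnS le_lm.
elim: k => [|k IH] le_km r.
  rewrite leq_eqVlt => /predU1P[->|]; first by rewrite /= -servicesE lineE.
  by rewrite ltnS leqn0 => /eqP ->; apply/setP => i; rewrite !inE.
rewrite leq_eqVlt => /predU1P[->|lt_r] /=.
  by rewrite below_collapse_max lineE.
rewrite below_collapse // lineE // IH // 1?ltnW // departures_id //.
by apply/subsetP => i; rewrite !inE => /leq_trans; apply; exact: leqW.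
Qed.
End Output.

(** * Invariant measures of the TASEP *)

Lemma gen_tperm_adjacent N :
  <<[set tperm (ord_pred i) i | i : 'I_N]>>%g = [set: 'S_N].
Proof.
case: N => [|n].
  by apply/eqP; rewrite eqEsubset subsetT; apply/subsetP => s _;
    rewrite (_ : s = 1%g) ?group1 //; apply/permP => -[].
(* Transpositions with a fixed step coprime to the length generate; here the step is 1 reduced
   modulo [n.+1]. *)
have cop : coprime n.+1 (ordS (@ord0 n)) by rewrite /= coprime_modr coprimen1.
rewrite -(gen_tperm_step cop); congr <<_>>%g.
have addE (i : 'I_n.+1) : (i + ordS ord0)%R = ordS i.
  by apply/val_inj; rewrite /= modnDmr addn1.
apply/setP => s; apply/imsetP/imsetP => -[i _ ->].
  by exists (ord_pred i) => //; rewrite addE ord_predK.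
by exists (ordS i) => //; rewrite addE ordSK.
Qed.

(** The permutations preserving [P] form a group, so it is enough that it contain the generators. *)
Lemma tperm_adjacent_ind N n (P : pred (config N n)) :
  (forall u i, P u -> P [ffun j => u (tperm (ord_pred i) i j)]) ->
  forall (s : 'S_N) u, P u -> P [ffun j => u (s j)].
Proof.
move=> Padj s; pose H := [set s : 'S_N | [forall u, P u ==> P [ffun j => u (s j)]]].
have HP (s' : 'S_N) : reflect (forall u, P u -> P [ffun j => u (s' j)]) (s' \in H).
  rewrite inE; apply: (iffP forallP) => Ps u; first exact/implyP/Ps.
  exact/implyP/Ps.
have gH : group_set H.
  apply/group_setP; split.
    apply/HP => u Pu; rewrite (_ : finfun _ = u) //.
    by apply/ffunP => j; rewrite ffunE perm1.
  move=> s1 s2 /HP H1 /HP H2; apply/HP => u /H2/H1.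
  by congr P; apply/ffunP => j; rewrite !ffunE permM.
suff : s \in Group gH by move/HP.
have : s \in <<[set tperm (ord_pred i) i | i : 'I_N]>>%g.
  by rewrite gen_tperm_adjacent inE.
apply/subsetP; rewrite gen_subG; apply/subsetP => _ /imsetP[i _ ->].
by apply/HP => u; exact: Padj.
Qed.

(** The content also fixes the number of holes, by complement, so the two configurations list the
    same values up to order. *)
Lemma content_perm N n p (u v : config N n) :
  has_content p u -> has_content p v -> exists s : 'S_N, v = [ffun j => u (s j)].
Proof.
move=> up vp.
have eq_card_val (c : 'I_n.+1) : #|[set i | v i == c]| = #|[set i | u i == c]|.
  have [lt_cn|le_nc] := ltnP c n; first by rewrite [LHS]vp // -(up c).
  have holeE (w : config N n) : [set i | w i == c] = ~: below n w.
    have cn : c = n :> nat by apply/eqP; rewrite eqn_leq le_nc -ltnS ltn_ord.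
    by apply/setP => i; rewrite !inE -leqNgt -val_eqE /= cn eqn_leq -ltnS ltn_ord.
  rewrite !holeE [LHS]cardsCs [RHS]cardsCs !setCK; congr (_ - _)%N.
  by rewrite (proj1 (has_contentP p v) vp) // (proj1 (has_contentP p u) up).
have : perm_eq [tuple v i | i < N] [tuple u i | i < N].
  have cE (w : config N n) c :
      count (fun i => w i == c) (enum 'I_N) = #|[set i | w i == c]|.
    by rewrite cardsE cardE -size_filter enumT.
  apply/allP => c _; rewrite /= !count_map -!enumT; apply/eqP.
  by rewrite -[LHS]/(count (fun i => v i == c) _) cE eq_card_val -cE.
case/tuple_permP=> s vs; exists s; apply/ffunP => j; rewrite ffunE.
have /(congr1 (fun t => tnth t j)) : [tuple v i | i < N] =
    [tuple tnth [tuple u i | i < N] (s i) | i < N].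
  exact/val_inj.
by rewrite !tnth_mktuple.
Qed.

Local Open Scope ring_scope.

Section Invariant.
Variables (R : realType) (N n : nat).
Implicit Types (mu eta : {ffun config N n -> R}) (f : config N n -> R).

(** The infinitesimal form of stationarity, [mu L = 0]. *)
Definition tasep_invariant mu : Prop :=
  forall f, \sum_u mu u * tasep_generator f u = 0.

(** Test invariance on the indicator of the zeros of [eta]: where [eta] is nonzero no increment is
    negative, so all terms of the vanishing sum are zero. *)
Lemma zeros_backward eta : tasep_invariant eta -> (forall u, 0 <= eta u) ->
  forall u i, eta (bell i u) = 0 -> eta u = 0.
Proof.
move=> inv ge0 u i Eb; apply/eqP/negPn/negP => u0.
have := inv (fun v => (eta v == 0)%:R) => /eqP; rewrite psumr_eq0 => [/allP/(_ u)|v _].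
  rewrite mem_index_enum => /(_ isT)/=; rewrite mulf_eq0 (negPf u0) /=.
  rewrite psumr_eq0 => [/allP/(_ i)|j _]; last by rewrite (negPf u0) subr0.
  by rewrite mem_index_enum => /(_ isT)/=; rewrite Eb eqxx (negPf u0) subr0 oner_eq0.
have [->|v0] := eqVneq (eta v) 0; first by rewrite mul0r.
by rewrite mulr_ge0 //; apply: sumr_ge0 => j _; rewrite (negPf v0) subr0.
Qed.

(** By [zeros_backward] the indicator of the zeros of [eta] never increases at a bell. Its generator
    has mean zero under [mu], so it never decreases either where [mu] is positive. *)
Lemma zeros_forward mu eta : tasep_invariant mu -> (forall u, 0 <= mu u) ->
  tasep_invariant eta -> (forall u, 0 <= eta u) ->
  forall u i, mu u != 0 -> eta u = 0 -> eta (bell i u) = 0.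
Proof.
move=> inv ge0 invE ge0E u i u0 Eu; apply/eqP/negPn/negP => b0.
have neg v j : (eta (bell j v) == 0)%:R - (eta v == 0)%:R <= 0 :> R.
  rewrite subr_le0 ler_nat.
  have [/(zeros_backward invE ge0E)->|//] := eqVneq (eta (bell j v)) 0.
  by rewrite eqxx.
have /eqP := inv (fun v => (eta v == 0)%:R); rewrite -oppr_eq0 -sumrN psumr_eq0 => [|v _].
  move/allP/(_ u); rewrite mem_index_enum => /(_ isT)/=.
  rewrite oppr_eq0 mulf_eq0 (negPf u0) /= -oppr_eq0 -sumrN psumr_eq0 => [|j _].
    move/allP/(_ i); rewrite mem_index_enum => /(_ isT)/=.
    by rewrite Eu eqxx (negPf b0) sub0r opprK oner_eq0.
  by rewrite oppr_ge0 neg.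
by rewrite -mulrN mulr_ge0 // oppr_ge0; apply: sumr_le0 => j _; exact: neg.
Qed.

(* With c the largest ratio nu / mu, the nonnegative invariant measure c mu - nu
   vanishes somewhere, hence at all configurations with content p. *)
Lemma invariant_unique p mu nu :
  is_distribution mu -> tasep_invariant mu -> (forall u, mu u != 0 <-> has_content p u) ->
  is_distribution nu -> tasep_invariant nu -> (forall u, nu u != 0 -> has_content p u) ->
  mu = nu.
Proof.
move=> [mu_ge0 mu1] inv_mu mu_p [nu_ge0 nu1] inv_nu nu_p.
have nu0 u : mu u = 0 -> nu u = 0.
  move=> u0; apply/eqP/negPn/negP => /nu_p/mu_p; by rewrite u0 eqxx.
have [w1 w1P] : exists w, mu w != 0.
  case: (pickP (fun w => mu w != 0)) => [w|mu0]; first by exists w.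
  have := oner_neq0 R; rewrite -mu1 big1 ?eqxx // => u _.
  by have /negbFE/eqP := mu0 u.
pose w0 := [arg max_(w > w1 | mu w != 0) nu w / mu w]%O.
have [w0P w0max] : mu w0 != 0 /\ forall w, mu w != 0 -> nu w / mu w <= nu w0 / mu w0.
  by rewrite /w0; case: arg_maxP.
pose c := nu w0 / mu w0.
pose eta : {ffun config N n -> R} := [ffun u => c * mu u - nu u].
have eta_ge0 u : 0 <= eta u.
  rewrite ffunE subr_ge0; have [u0|u0] := eqVneq (mu u) 0.
    by rewrite u0 nu0 // mulr0.
  by rewrite -ler_pdivrMr ?w0max // lt0r u0 mu_ge0.
have inv_eta : tasep_invariant eta.
  move=> f; have := inv_mu f; have := inv_nu f => nuf muf.
  transitivity (c * \sum_u mu u * tasep_generator f u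
                - \sum_u nu u * tasep_generator f u).
    rewrite mulr_sumr -sumrB; apply: eq_bigr => u _; rewrite ffunE; ring.
  by rewrite nuf muf mulr0 subr0.
pose P u := (mu u != 0) && (eta u == 0).
have P0 : P w0 by rewrite /P w0P ffunE /c divfK // subrr eqxx.
have Padj u i : P u -> P [ffun j => u (tperm (ord_pred i) i j)].
  set v := finfun _; case/andP=> u0 /eqP Eu; apply/andP; split.
    apply/mu_p/has_contentP => r le_rn; rewrite card_below_tperm.
    exact: (proj1 (has_contentP p u) (proj1 (mu_p u) u0)).
  (* The swapped configuration [v] is either the result of the bell on [u], or has [u] as the result
     of its own bell; zeros propagate forward or backward accordingly. *)
  have [ltu|leu] := ltnP (u i) (u (ord_pred i)).
    have := zeros_forward inv_mu mu_ge0 inv_eta eta_ge0 i u0 Eu.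
    by rewrite bell_tperm leqNgt ltu /= -/v => ->.
  apply/eqP/(zeros_backward inv_eta eta_ge0 (i := i)).
  have -> : bell i v = if (u i <= u (ord_pred i))%N then v
                       else [ffun j => v (tperm (ord_pred i) i j)].
    by rewrite bell_tperm [v (ord_pred i)]ffunE [v i]ffunE tpermL tpermR.
  have vv : [ffun j => v (tperm (ord_pred i) i j)] = u.
    by apply/ffunP => j; rewrite !ffunE tpermK.
  case: ifP => [le'|_]; last by rewrite vv.
  have Eu' : u (ord_pred i) = u i by apply/val_inj/anti_leq; rewrite leu le'.
  rewrite (_ : v = u) //; apply/ffunP => j; rewrite ffunE.
  by case: tpermP => [->|->|_ _]; rewrite ?Eu'.
have eta0 u : eta u = 0.
  have [u0|u0] := eqVneq (mu u) 0; first by rewrite ffunE u0 nu0 // mulr0 subr0.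
  have [s ->] := content_perm (proj1 (mu_p _) w0P) (proj1 (mu_p _) u0).
  by have /andP[_ /eqP] := tperm_adjacent_ind Padj s P0.
have nuE u : nu u = c * mu u.
  by apply/esym/eqP; rewrite -subr_eq0; have := eta0 u; rewrite ffunE => ->.
(* Both measures have total mass 1. *)
have c1 : c = 1.
  rewrite -[LHS]mulr1 -[X in _ * X]mu1 mulr_sumr -[RHS]nu1.
  by apply: eq_bigr => u _; rewrite nuE.
by apply/ffunP => u; rewrite nuE c1 mul1r.
Qed.

End Invariant.

(** * Stationarity for the semigroup and for the generator *)

Section Semigroup.
Variables (R : realType) (N n : nat).
Implicit Types (mu : {ffun config N n -> R}) (f : config N n -> R).
Let L := @tasep_generator N n R.
Let C : R := (2 * N)%:R.

(** The generator is a sum of [N] differences, so its sup-norm is at most [C = 2 N]. *)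
Lemma iter_generator_bound f k u : (forall v, `|f v| <= 1) ->
  `|iter k L f u| <= C ^+ k.
Proof.
move=> f1; elim: k u => [|k IH] u /=; first exact: f1.
apply: le_trans (ler_norm_sum _ _ _) _.
apply: (@le_trans _ _ (\sum_(i < N) 2 * C ^+ k)).
  apply: ler_sum => i _; apply: le_trans (ler_normB _ _) _.
  by rewrite mulr_natl mulr2n lerD.
by rewrite sumr_const card_ord exprS -[_ *+ N]mulr_natl mulrA /C natrM [N%:R * _]mulrC.
Qed.

(** By linearity, invariance need only be tested on indicators of points. *)
Lemma generator_sum f u : L f u = \sum_w f w * L (fun v => (v == w)%:R) u.
Proof.
have fE v : f v = \sum_w f w * (v == w)%:R.
  rewrite (bigD1 v) //= eqxx mulr1 big1 ?addr0 // => w wv.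
  by rewrite eq_sym (negPf wv) mulr0.
transitivity (\sum_(i < N) \sum_w f w * ((bell i u == w)%:R - (u == w)%:R)).
  apply: eq_bigr => i _; rewrite (fE (bell i u)) [X in _ - X](fE u) -sumrB.
  by apply: eq_bigr => w _; rewrite mulrBr.
by rewrite exchange_big; apply: eq_bigr => w _; rewrite -mulr_sumr.
Qed.

Lemma cvg_transition f t u : (forall v, `|f v| <= 1) -> 0 <= t ->
  cvgn (series (fun k => t ^+ k / k`!%:R * iter k L f u)).
Proof.
move=> f1 t0; apply: normed_cvg.
apply: series_le_cvg (is_cvg_series_exp_coeff (t * C)) => k /=.
- exact: normr_ge0.
- by rewrite exp_coeff_ge0 // mulr_ge0.
- rewrite normrM ger0_norm ?divr_ge0 ?exprn_ge0 //.
  rewrite /exp_coeff /= exprMn [leRHS]mulrAC ler_wpM2l ?divr_ge0 ?exprn_ge0 //.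
  exact: iter_generator_bound.
Qed.

(** The [k]-th derivative at 0 of [t -> mu P_t f]. *)
Definition moment mu f k : R := \sum_u mu u * iter k L f u.

Lemma cvg_moments mu f t : (forall v, `|f v| <= 1) -> 0 <= t ->
  (series (fun k => t ^+ k / k`!%:R * moment mu f k) @ \oo -->
   \sum_u mu u * limn (series (fun k => t ^+ k / k`!%:R * iter k L f u)))%classic.
Proof.
move=> f1 t0.
have -> : series (fun k => t ^+ k / k`!%:R * moment mu f k) =
    (fun m => \sum_u mu u * series (fun k => t ^+ k / k`!%:R * iter k L f u) m).
  apply/funext => m; rewrite /series /=.
  under [RHS]eq_bigr do rewrite mulr_sumr.
  rewrite exchange_big /=; apply: eq_bigr => k _; rewrite mulr_sumr.
  by apply: eq_bigr => u _; rewrite mulrCA.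
apply: cvg_big => [|u _]; first exact: add_continuous.
by apply: cvgMl_tmp; exact: cvg_transition.
Qed.

Lemma invariant_stationary mu : tasep_invariant mu -> tasep_stationary mu.
Proof.
move=> inv t w t0; set f := fun v => (v == w)%:R : R.
have f1 v : `|f v| <= 1 by rewrite /f normr_nat lern1 leq_b1.
have m0 : moment mu f 0 = mu w.
  rewrite /moment (bigD1 w) //= /f eqxx mulr1 big1 ?addr0 // => u /negPf->.
  by rewrite mulr0.
(* Invariance is applied to the function [iter k L f]; only the constant term of the series
   survives. *)
have mS k : moment mu f k.+1 = 0 by exact: inv.
rewrite -[LHS](cvg_lim _ (@cvg_moments mu f t f1 t0)) //; apply: cvg_lim => //.
apply: cvg_near_cst; exists 1%N => // m /= m1.
rewrite /series /= big_ltn // big1_seq ?addr0.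
  by rewrite expr0 fact0 divr1 mul1r.
move=> k; rewrite mem_index_iota => /andP[_ /andP[k1 _]].
by rewrite -(prednK k1) mS mulr0.
Qed.

(** The first moment is the derivative at 0 of the constant function [t -> (mu P_t)(w)]; it vanishes
    because the rest of the series is of order [t ^+ 2]. *)
Lemma stationary_invariant mu :
  is_distribution mu -> tasep_stationary mu -> tasep_invariant mu.
Proof.
move=> [mu_ge0 mu1] stat.
have C0 : 0 <= C by [].
suff inv w : \sum_u mu u * L (fun v => (v == w)%:R) u = 0.
  move=> f; under eq_bigr do rewrite -/L generator_sum mulr_sumr.
  rewrite exchange_big big1 // => w _.
  under eq_bigr do rewrite mulrCA.
  by rewrite -mulr_sumr inv mulr0.
set f := fun v => (v == w)%:R : R; rewrite -/(moment mu f 1).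
have f1 v : `|f v| <= 1 by rewrite /f normr_nat lern1 leq_b1.
have m0 : moment mu f 0 = mu w.
  rewrite /moment (bigD1 w) //= /f eqxx mulr1 big1 ?addr0 // => u /negPf->.
  by rewrite mulr0.
have mC k : `|moment mu f k| <= C ^+ k.
  apply: le_trans (ler_norm_sum _ _ _) _.
  rewrite -[X in _ <= X]mul1r -mu1 mulr_suml; apply: ler_sum => u _.
  by rewrite normrM ger0_norm // ler_wpM2l // iter_generator_bound.
set E := limn (series (exp_coeff C)).
have expE m : series (exp_coeff C) m <= E.
  apply: nondecreasing_cvgn_le (is_cvg_series_exp_coeff C) m.
  by apply: nondecreasing_series => k _ _; exact: exp_coeff_ge0.
(* Second order Taylor bound for the constant function t -> (mu P_t)(w). *)
have bound t : 0 <= t -> t <= 1 -> t * `|moment mu f 1| <= t ^+ 2 * E.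
  move=> t0 t1; have := @cvg_moments mu f t f1 t0; rewrite (stat t w t0) => cv.
  have {}cv : (`|series (fun k => t ^+ k / k`!%:R * moment mu f k) m
                - mu w - t * moment mu f 1| @[m --> \oo] -->
               `|mu w - mu w - t * moment mu f 1|)%classic.
    by apply: cvg_norm; apply: cvgB; [apply: cvgB |]; [exact: cv | exact: cvg_cst ..].
  rewrite subrr sub0r normrN normrM ger0_norm // in cv.
  rewrite -(cvg_lim _ cv) //; apply: limr_le.
    by apply/cvg_ex; eexists; exact: cv.
  exists 2%N => // m /= m2.
  rewrite /series /= big_ltn; last by lia.
  rewrite big_ltn; last by lia.
  rewrite expr0 fact0 divr1 mul1r m0 expr1 divr1.
  set s := \sum_(_ <= _ < _) _.
  rewrite (_ : _ - _ - _ = s); last by ring.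
  apply: le_trans (ler_norm_sum _ _ _) _.
  (* For [t <= 1] and [k >= 2], [t ^+ k] is at most [t ^+ 2]. *)
  apply: (@le_trans _ _ (t ^+ 2 * \sum_(2 <= k < m) exp_coeff C k)).
    rewrite mulr_sumr big_nat [X in _ <= X]big_nat; apply: ler_sum => k /andP[k2 _].
    rewrite normrM ger0_norm ?divr_ge0 ?exprn_ge0 // /exp_coeff /=.
    rewrite [C ^+ k / _]mulrC mulrA; apply: ler_pM => //.
      by rewrite divr_ge0 ?exprn_ge0.
    by apply: ler_wpM2r; [rewrite invr_ge0 | exact: ler_wiXn2l].
  rewrite ler_wpM2l ?exprn_ge0 //; apply: le_trans (expE m).
  rewrite /series /= [X in _ <= X](big_cat_nat _ (n := 2)) //= lerDr.
  by apply: sumr_ge0 => k _; exact: exp_coeff_ge0.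
have E0 : 0 < E.
  apply: lt_le_trans (expE 1%N).
  by rewrite /series /= big_nat1 /exp_coeff /= expr0 fact0 divr1.
apply/normr0_eq0/eqP; rewrite eq_le normr_ge0 andbT leNgt; apply/negP => a0.
set a := `|_| in a0 bound *.
have aE : 0 < a + 2 * E by rewrite addr_gt0 // mulr_gt0.
(* This [t] lies in []0, 1]] and satisfies [t * E < a], which contradicts [bound]. *)
set t := a / (a + 2 * E).
have t0 : 0 < t by rewrite divr_gt0.
have t1 : t <= 1 by rewrite ler_pdivrMr // mul1r lerDl mulr_ge0 // ltW.
have := bound t (ltW t0) t1; rewrite expr2 -mulrA ler_pM2l // /t mulrAC.
rewrite ler_pdivlMr //; nra.
Qed.

End Semigroup.

(** * The law of the output *)

Lemma sum_law (R : realType) (T U : finType) (mu : {ffun T -> R}) (g : T -> U)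
    (h : U -> R) :
  \sum_u law mu g u * h u = \sum_x mu x * h (g x).
Proof.
rewrite (partition_big g xpredT) //=; apply: eq_bigr => u _.
by rewrite ffunE mulr_suml; apply: eq_bigr => x /eqP ->.
Qed.

Lemma sum_uniform_on (R : realType) (T : finType) (A : {set T}) (h : T -> R) :
  \sum_x uniform_on R A x * h x = #|A|%:R^-1 * \sum_(x in A) h x.
Proof.
rewrite mulr_sumr [RHS]big_mkcond; apply: eq_bigr => x _.
by rewrite ffunE; case: ifP; rewrite ?mul0r.
Qed.

Section Output_law.
Variables (R : realType) (N n : nat) (p : nat -> nat) (m : nat).
Hypotheses (hN : (partial_sum p n.-1 <= N)%N) (lt_mn : (m < n)%N).
Let X := multiline_set N n (partial_sum p).
Let mu := law (uniform_on R X) (fun x : lines N n => output x m).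

Lemma output_law_invariant : tasep_invariant mu.
Proof.
move=> f; rewrite sum_law sum_uniform_on /tasep_generator.
rewrite exchange_big /=; under eq_bigr do rewrite sumrB; rewrite sumrB.
rewrite !(pair_big xpredT (mem X)) /=.
(* The loss term, a sum over pairs of a site and a multi-line configuration, is reindexed by the
   lifted bell and becomes the gain term. *)
rewrite [X in _ * (_ - X)](reindex_inj (multi_bell_inj lt_mn)) /=.
rewrite (_ : _ - _ = 0) ?mulr0 //; apply/eqP; rewrite subr_eq0; apply/eqP.
rewrite [RHS](eq_bigl (fun ix => ix.2 \in X)) => [|ix]; last first.
  by rewrite multi_bell_multiline.
by apply: eq_bigr => -[i x] /= xX; rewrite (@output_multi_bell _ _ p).
Qed.

Lemma card_multiline_gt0 : (0 < #|X|)%N.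
Proof.
(* A configuration without classes imposes nothing, so all lines are initial segments. *)
apply/card_gt0P; exists (lines_of n p ([ffun=> ord0] : config N 0)).
by apply: (@lines_of_multiline _ _ _ 0).
Qed.

Lemma output_law_distribution : is_distribution mu.
Proof.
split=> [u|].
  by rewrite ffunE sumr_ge0 // => x _; rewrite ffunE; case: ifP => // _; rewrite invr_ge0.
under eq_bigr do rewrite -[mu _]mulr1.
rewrite sum_law sum_uniform_on sumr_const mulVf // pnatr_eq0 -lt0n.
exact: card_multiline_gt0.
Qed.

(** Every output of a line system in [X] has this content; conversely [lines_of] gives a system in
    [X] with output [u], hence a positive term. *)
Lemma output_law_neq0 u : mu u != 0 <-> has_content p u.
Proof.
rewrite ffunE; split=> [|up].
  rewrite (bigID (mem X)) /= [X in _ + X]big1 => [|x /andP[_ /negPf xX]]; last first.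
    by rewrite ffunE xX.
  case: (pickP (fun x => (output x m == u) && (x \in X))) => [x /andP[/eqP <- xX] _|no].
    exact: output_content xX lt_mn.
  by rewrite big_pred0 // addr0 eqxx.
rewrite psumr_neq0 => [|x _]; last first.
  by rewrite ffunE; case: ifP => // _; rewrite invr_ge0.
apply/hasP; exists (lines_of n p u); first exact: mem_index_enum.
rewrite output_lines_of // eqxx ffunE lines_of_multiline //.
by rewrite invr_gt0 ltr0n card_multiline_gt0.
Qed.

End Output_law.

Theorem theorem2p2 (R : realType) (n N : nat) (hn : (1 < n)%N) (hN : (1 <= N)%N)
    (p : nat -> nat) (hp : (\sum_(r < n) p r <= N)%N) (m : 'I_n) :
  unique (@tasep_stationary_with N m.+1 R p)
    (law (uniform_on R (multiline_set N n (partial_sum p)))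
       (fun x : lines N n => output x m)).
Proof.
have qN : (partial_sum p n.-1 <= N)%N by rewrite /partial_sum prednK // ltnW.
have dist := output_law_distribution R m qN.
have inv := @output_law_invariant R N n p m (ltn_ord m).
have supp := @output_law_neq0 R N n p m qN (ltn_ord m).
split=> [|nu [nu_dist nu_stat nu_supp]].
  by split=> // [|u /supp//]; exact: invariant_stationary.
apply: (invariant_unique dist inv supp nu_dist _ nu_supp).
exact: stationary_invariant.
Qed.
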